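(* Let $\mathbf{k}$ be a field, $G$ a finite group, $A$ a partial $\mathbf{k}G$-module algebra, and $B$ a unital enveloping $\mathbf{k}G$-module algebra of $A$, with embedding $\varphi:A\to B$. Identify $A$ with $\varphi(A)$, let $\mathbf{1}_g=g\rhd 1_A$ for $g\in G$, and assume that each idempotent $\mathbf{1}_g$ is central in $B$. Consider the ideals $\widehat{D}_g=B\mathbf{1}_g$ of $B$ as right $B$-modules and let $M=\bigoplus_{g\in G}\widehat{D}_g$. Then $$(\underline{A\#\mathbf{k}G})\#\mathbf{k}G^*\simeq S(M)\simeq L(M)\simeq\operatorname{End}_B(M)$$ as $\mathbf{k}$-algebras.
   Context: All algebras are associative $\mathbf{k}$-algebras; $\mathbf{k}G^*$ denotes the Hopf algebra dual to the group algebra $\mathbf{k}G$. For a Hopf algebra $H$ (here $H=\mathbf{k}G$), a (left) partial $H$-module algebra is a unital algebra $A$ with a linear map $H\otimes A\to A$, $h\otimes a\mapsto h\cdot a$, such that $h\cdot(ab)=\sum(h_{(1)}\cdot a)(h_{(2)}\cdot b)$, $1_H\cdot a=a$, and $h\cdot(k\cdot a)=\sum(h_{(1)}\cdot 1_A)((h_{(2)}k)\cdot a)$ for all $a,b\in A$, $h,k\in H$. An enveloping $H$-module algebra of $A$ is a left $H$-module algebra $B$ (action $h\rhd b$) with an algebra monomorphism $\varphi:A\to B$ (not necessarily preserving unities) such that $\varphi(A)$ is a right ideal of $B$ and $\varphi(h\cdot a)=\varphi(1_A)(h\rhd\varphi(a))$ for all $h\in H$, $a\in A$. It is called unital if $B$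 is a unital algebra. The partial smash product $\underline{A\# H}$ is the linear span of the elements $\sum a(h_{(1)}\cdot 1_A)\# h_{(2)}$ ($a\in A$, $h\in H$) in $A\otimes H$, with product induced by $(a\otimes h)(b\otimes k)=\sum a(h_{(1)}\cdot b)\otimes h_{(2)}k$; it is a unital algebra with unity $1_A\# 1_H$. $H^*$ acts on it by $f\cdot(a\# h)=\sum a\# h_{(1)}f(h_{(2)})$, and $(\underline{A\# H})\# H^*$ is the corresponding smash product, with product $(x\# f)(y\# g)=\sum x(f_{(1)}\cdot y)\# f_{(2)}g$. Let $n=|G|$ and index the rows and columns of $n\times n$ matrices by $G$. Then $$S(M)=\{(a_{g,h})\in M_n(B)\mid a_{g,h}\in\widehat{D}_g\widehat{D}_h\text{ for all }g,h\in G\},$$ a subalgebra (for matrix multiplication) of $M_n(B)$ with its own unity $\sum_{g}\mathbf{1}_gE_{g,g}$, where $E_{g,g}$ are the diagonal matrix units; and $$L(M)=\{(f_{g,h})\in M_n(\operatorname{End}_B(M))\mid f_{g,h}\in\operatorname{Hom}_B(\widehat{D}_h,\widehat{D}_g)\text{ for all }g,h\in G\},$$ an algebra under matrix multiplication, where $\operatorname{Hom}_B(\widehat{D}_h,\widehat{D}_g)$ (right $B$-module maps) is identified with the set of endomorphisms of $M$ that map the summand $\widehat{D}_h$ into $\widehat{D}_g$ and vanish on all other summands. $\operatorname{End}_B(M)$ is the algebra of right $B$-module endomorphisms of $M$. *)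

(* Defs.v *)
(* A tensor product V (x) k^X with a space that has a finite basis X is
   represented by {ffun X -> V}: the tensor \sum_x v_x (x) x is x |-> v_x.
   This applies to kG (x) kG, A (x) kG and (A # kG) (x) kG^*.              *)
From HB Require Import structures.
From mathcomp Require Import all_boot all_order all_algebra all_fingroup.
From mathcomp Require Import boolp functions.

Set Implicit Arguments.
Unset Strict Implicit.
Unset Printing Implicit Defensive.

Import GRing.Theory.
Local Open Scope ring_scope.

Definition alg_isomorphic (k : fieldType) (X Y : algType k) : Prop :=
  exists f : {lrmorphism X -> Y}, bijective f.

Section Span.
Variables (k : fieldType) (V : lmodType k).

Definition span (P : V -> Prop) (x : V) : Prop :=
  exists2 s : seq (k * V), (forall p, p \in s -> P p.2) &
    x = \sum_(p <- s) p.1 *: p.2.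

Lemma span_closed (P : V -> Prop) : subsemimod_closed (fun x => `[< span P x >]).
Proof.
do 2?[split] => [|x y|c x]; rewrite ?unfold_in /=.
- by apply/asboolP; exists [::] => //; rewrite big_nil.
- move=> /asboolP[s sP ->] /asboolP[t tP ->]; apply/asboolP.
  exists (s ++ t); last by rewrite big_cat.
  by move=> p; rewrite mem_cat => /orP[/sP|/tP].
- move=> /asboolP[s sP ->]; apply/asboolP.
  exists [seq (c * p.1, p.2) | p <- s]; first by move=> _ /mapP[p /sP ? ->].
  by rewrite big_map scaler_sumr; apply: eq_bigr => p _; rewrite scalerA.
Qed.

Lemma span_gen (P : V -> Prop) x : P x -> span P x.
Proof.
move=> Px; exists [:: (1, x)]; last by rewrite big_seq1 scale1r.
by move=> p; rewrite inE => /eqP ->.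
Qed.

Lemma span_ind (P Q : V -> Prop) : Q 0 ->
    (forall c x y, Q x -> Q y -> Q (c *: x + y)) -> (forall x, P x -> Q x) ->
  forall x, span P x -> Q x.
Proof.
move=> Q0 Qlin PQ x [s sP ->]; elim: s sP => [|p s IH] sP.
  by rewrite big_nil.
rewrite big_cons; apply: Qlin.
  by apply/PQ/sP; rewrite inE eqxx.
by apply: IH => q qs; apply: sP; rewrite inE qs orbT.
Qed.
End Span.

Section Tensors.
Variables (k : fieldType) (X : finType).

Definition basis_elt (x : X) : {ffun X -> k^o} := [ffun y => (y == x)%:R].

Definition pure_tensor (V : lmodType k) (v : V) (h : {ffun X -> k^o}) :
  {ffun X -> V} := [ffun x => h x *: v].

(* The value at t of the linear map k^X (x) k^X -> V induced by a bilinear F.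
   If t = Delta(h), it is the Sweedler sum of the F h_(1) h_(2).            *)
Definition tensor_eval (V : lmodType k) (t : {ffun X * X -> k^o})
    (F : {ffun X -> k^o} -> {ffun X -> k^o} -> V) : V :=
  \sum_p t p *: F (basis_elt p.1) (basis_elt p.2).

Lemma basis_decomp (h : {ffun X -> k^o}) : h = \sum_x h x *: basis_elt x.
Proof.
apply/ffunP => y; rewrite sum_ffunE (bigD1 y) //= !ffunE eqxx [_ *: _]mulr1.
by rewrite big1 ?addr0 // => x /negPf nxy; rewrite !ffunE eq_sym nxy [_ *: _]mulr0.
Qed.

Lemma basis_sum (V : lmodType k) (x : X) (F : X -> V) :
  \sum_y basis_elt x y *: F y = F x.
Proof.
rewrite (bigD1 x) //= ffunE eqxx scale1r big1 ?addr0 // => y /negPf nyx.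
by rewrite ffunE nyx scale0r.
Qed.

Lemma basis_sumr (V : lmodType k) (x : X) (F : X -> V) :
  \sum_y basis_elt y x *: F y = F x.
Proof.
rewrite -[RHS](basis_sum x F); apply: eq_bigr => y _.
by rewrite !ffunE eq_sym.
Qed.

End Tensors.

Arguments basis_elt {k X} x.

Section GroupAlgebra.
Variables (k : fieldType) (G : finGroupType).

Definition grp_alg : Type := {ffun G -> k^o}.
HB.instance Definition _ := GRing.Lmodule.on grp_alg.
Implicit Types h l : grp_alg.

Definition ga_one : grp_alg := basis_elt 1%g.
Definition ga_mul h l : grp_alg :=
  \sum_u \sum_v (h u * l v) *: basis_elt (u * v)%g.

Lemma ga_mulE h l x : ga_mul h l x = \sum_u h u * l (u^-1 * x)%g.
Proof.
rewrite /ga_mul sum_ffunE; apply: eq_bigr => u _; rewrite sum_ffunE.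
rewrite (bigD1 (u^-1 * x)%g) //= !ffunE mulKVg eqxx [_ *: _]mulr1 big1 ?addr0 //.
move=> v nvx; rewrite !ffunE; case: eqP => [xE|_]; last by rewrite [_ *: _]mulr0.
by rewrite xE mulKg eqxx in nvx.
Qed.

Lemma ga_mulA : associative ga_mul.
Proof.
move=> a b c; apply/ffunP => x; rewrite !ga_mulE.
under eq_bigr do rewrite ga_mulE mulr_sumr.
under [RHS]eq_bigr do rewrite ga_mulE mulr_suml.
rewrite [RHS]exchange_big; apply: eq_bigr => u _ /=.
rewrite [RHS](reindex_inj (mulgI u)) /=; apply: eq_bigr => v _.
by rewrite mulrA mulKg invMg mulgA.
Qed.

Lemma ga_mul1 : left_id ga_one ga_mul.
Proof.
move=> a; apply/ffunP => x; rewrite ga_mulE.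
by have := basis_sum 1%g (fun u => a (u^-1 * x)%g : k^o); rewrite invg1 mul1g.
Qed.

Lemma ga_mul1r : right_id ga_one ga_mul.
Proof.
move=> a; apply/ffunP => x; rewrite ga_mulE (bigD1 x) //= mulVg ffunE eqxx mulr1.
rewrite big1 ?addr0 // => u nux; rewrite ffunE; case: eqP => [uE|]; last by rewrite mulr0.
by case/eqP: nux; rewrite -[x](mulKVg u) uE mulg1.
Qed.

Lemma ga_mulDl : left_distributive ga_mul +%R.
Proof.
move=> a b c; apply/ffunP => x; rewrite !(ffunE, ga_mulE) -big_split /=.
by apply: eq_bigr => u _; rewrite ffunE mulrDl.
Qed.

Lemma ga_mulDr : right_distributive ga_mul +%R.
Proof.
move=> a b c; apply/ffunP => x; rewrite !(ffunE, ga_mulE) -big_split /=.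
by apply: eq_bigr => u _; rewrite ffunE mulrDr.
Qed.

Lemma ga_one_neq0 : ga_one != 0.
Proof. by apply/eqP => /ffunP/(_ 1%g)/eqP; rewrite !ffunE eqxx oner_eq0. Qed.

HB.instance Definition _ := GRing.Zmodule_isNzRing.Build grp_alg
  ga_mulA ga_mul1 ga_mul1r ga_mulDl ga_mulDr ga_one_neq0.

Lemma ga_scaleAl (c : k) h l : c *: (h * l) = (c *: h) * l.
Proof.
apply/ffunP => x; rewrite !(ffunE, ga_mulE) [LHS]mulr_sumr.
by apply: eq_bigr => u _; rewrite ffunE mulrA.
Qed.

Lemma ga_scaleAr (c : k) h l : c *: (h * l) = h * (c *: l).
Proof.
apply/ffunP => x; rewrite !(ffunE, ga_mulE) [LHS]mulr_sumr.
by apply: eq_bigr => u _; rewrite ffunE mulrCA.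
Qed.

HB.instance Definition _ := GRing.Lmodule_isLalgebra.Build k grp_alg ga_scaleAl.
HB.instance Definition _ := GRing.Lalgebra_isAlgebra.Build k grp_alg ga_scaleAr.

Definition ga_comul h : {ffun G * G -> k^o} := \sum_g h g *: basis_elt (g, g).
Definition ga_counit h : k := \sum_g h g.

Lemma ga_comulE (V : lmodType k) (g : G) (F : grp_alg -> grp_alg -> V) :
  tensor_eval (ga_comul (basis_elt g)) F = F (basis_elt g) (basis_elt g).
Proof. by rewrite /ga_comul basis_sum /tensor_eval basis_sum. Qed.

Lemma ga_basisM (u v : G) :
  (basis_elt u : grp_alg) * basis_elt v = basis_elt (u * v)%g.
Proof.
rewrite {1}/GRing.mul /= /ga_mul.
under eq_bigr => x _ do (under eq_bigr => y _ do rewrite -scalerA; rewrite -scaler_sumr).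
by rewrite basis_sum basis_sum.
Qed.

Lemma ga_counit_basis (g : G) : ga_counit (basis_elt g) = 1.
Proof. by rewrite -[RHS](basis_sum g (fun=> 1 : k^o)); apply: eq_bigr => x _; rewrite [RHS]mulr1. Qed.

End GroupAlgebra.

Section DualGroupAlgebra.
Variables (k : fieldType) (G : finGroupType).

(* A linear functional on kG, given by its values on the basis G; the
   functions [basis_elt g] form the basis dual to G.                        *)
Definition dual_alg : Type := {ffun G -> k^o}.
HB.instance Definition _ := GRing.Lmodule.on dual_alg.
Implicit Types f g : dual_alg.

Definition pairing f (h : grp_alg k G) : k := \sum_x f x * h x.

(* The product and the coproduct of kG^* are transposed to Delta and to the
   product of kG, and its unity is the counit of kG.                        *)
Definition da_mul f g : dual_alg := [ffun x =>
  tensor_eval (ga_comul (basis_elt x))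
    (fun h1 h2 : grp_alg k G => pairing f h1 * pairing g h2 : k^o)].
Definition da_one : dual_alg := [ffun x => ga_counit (basis_elt x : grp_alg k G)].
Definition da_comul f : {ffun G * G -> k^o} :=
  [ffun p => pairing f ((basis_elt p.1 : grp_alg k G) * basis_elt p.2)].

Lemma pairing_basis f x : pairing f (basis_elt x) = f x.
Proof.
rewrite -[RHS](basis_sum x (f : G -> k^o)); apply: eq_bigr => y _.
by rewrite mulrC.
Qed.

Lemma da_mulE f g x : da_mul f g x = f x * g x.
Proof. by rewrite ffunE ga_comulE !pairing_basis. Qed.

Lemma da_oneE x : da_one x = 1.
Proof. by rewrite ffunE ga_counit_basis. Qed.

Lemma da_comulE f p : da_comul f p = f (p.1 * p.2)%g.
Proof. by rewrite ffunE ga_basisM pairing_basis. Qed.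

Lemma da_mulA : associative da_mul.
Proof. by move=> a b c; apply/ffunP => x; rewrite !da_mulE mulrA. Qed.
Lemma da_mul1 : left_id da_one da_mul.
Proof. by move=> a; apply/ffunP => x; rewrite da_mulE da_oneE mul1r. Qed.
Lemma da_mul1r : right_id da_one da_mul.
Proof. by move=> a; apply/ffunP => x; rewrite da_mulE da_oneE mulr1. Qed.
Lemma da_mulDl : left_distributive da_mul +%R.
Proof. by move=> a b c; apply/ffunP => x; rewrite !(da_mulE, ffunE (fun y => _ y + _ y)) mulrDl. Qed.
Lemma da_mulDr : right_distributive da_mul +%R.
Proof. by move=> a b c; apply/ffunP => x; rewrite !(da_mulE, ffunE (fun y => _ y + _ y)) mulrDr. Qed.
Lemma da_one_neq0 : da_one != 0.
Proof. by apply/eqP => /ffunP/(_ 1%g)/eqP; rewrite da_oneE ffunE oner_eq0. Qed.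

HB.instance Definition _ := GRing.Zmodule_isNzRing.Build dual_alg
  da_mulA da_mul1 da_mul1r da_mulDl da_mulDr da_one_neq0.

Lemma dual_algM f g x : (f * g) x = f x * g x.
Proof. exact: da_mulE. Qed.

Lemma da_scaleAl (c : k) f g : c *: (f * g) = (c *: f) * g.
Proof. by apply/ffunP => x; rewrite !(ffunE (fun y => _ *: _ y), da_mulE) [LHS]mulrA. Qed.
Lemma da_scaleAr (c : k) f g : c *: (f * g) = f * (c *: g).
Proof. by apply/ffunP => x; rewrite !(ffunE (fun y => _ *: _ y), da_mulE) [LHS]mulrCA. Qed.

HB.instance Definition _ := GRing.Lmodule_isLalgebra.Build k dual_alg da_scaleAl.
HB.instance Definition _ := GRing.Lalgebra_isAlgebra.Build k dual_alg da_scaleAr.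

End DualGroupAlgebra.

Section PartialSmash.
Variables (k : fieldType) (G : finGroupType) (A : algType k).
Local Notation kG := (grp_alg k G).
Local Notation kGd := (dual_alg k G).

Record is_partial_module_algebra (act : kG -> A -> A) : Prop := {
  pact_linear_l : forall a, linear (act^~ a);
  pact_linear_r : forall h, linear (act h);
  pactM : forall h a b, act h (a * b) =
    tensor_eval (ga_comul h) (fun h1 h2 : kG => act h1 a * act h2 b);
  pact1 : forall a, act 1 a = a;
  pactA : forall h l a, act h (act l a) =
    tensor_eval (ga_comul h) (fun h1 h2 : kG => act h1 1 * act (h2 * l) a) }.

Structure partial_module_algebra := PartialModuleAlgebra {
  pact :> kG -> A -> A;
  pactP : is_partial_module_algebra pact }.

Variable alpha : partial_module_algebra.

Lemma pact0r h : alpha h 0 = 0.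
Proof. by have := pact_linear_r (pactP alpha) h (-1) 0 0; rewrite !scaleN1r !addNr. Qed.
Lemma pactDr h a b : alpha h (a + b) = alpha h a + alpha h b.
Proof. by rewrite -[a]scale1r (pact_linear_r (pactP alpha)) !scale1r. Qed.
Lemma pactZr h c a : alpha h (c *: a) = c *: alpha h a.
Proof. by rewrite -[c *: a]addr0 (pact_linear_r (pactP alpha)) pact0r addr0. Qed.
Lemma pact_sumr h I (r : seq I) (P : pred I) (F : I -> A) :
  alpha h (\sum_(i <- r | P i) F i) = \sum_(i <- r | P i) alpha h (F i).
Proof. by apply: (big_morph (alpha h) (pactDr h) (pact0r h)). Qed.
Lemma pactM_basis (g : G) a b :
  alpha (basis_elt g) (a * b) = alpha (basis_elt g) a * alpha (basis_elt g) b.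
Proof. by rewrite (pactM (pactP alpha)) ga_comulE. Qed.
Lemma pactA_basis (g h : G) a : alpha (basis_elt g) (alpha (basis_elt h) a) =
  alpha (basis_elt g) 1 * alpha (basis_elt (g * h)%g) a.
Proof. by rewrite (pactA (pactP alpha)) ga_comulE ga_basisM. Qed.
Lemma pact1_basis a : alpha (basis_elt 1%g) a = a.
Proof. exact: (pact1 (pactP alpha)). Qed.

(* The product of A (x) kG induced by
   (a (x) h)(b (x) l) = \sum a (h_(1) . b) (x) h_(2) l.                     *)
Definition smash_mul (x y : {ffun G -> A}) : {ffun G -> A} :=
  \sum_g \sum_l tensor_eval (ga_comul (basis_elt g))
    (fun h1 h2 : kG => pure_tensor (x g * alpha h1 (y l)) (h2 * basis_elt l)).

Definition psmash_gen (x : {ffun G -> A}) : Prop :=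
  exists (a : A) (h : kG), x =
    tensor_eval (ga_comul h) (fun h1 h2 : kG => pure_tensor (a * alpha h1 1) h2).

Record psmash := PSmash {
  psmash_val :> {ffun G -> A};
  psmash_valP : `[< span psmash_gen psmash_val >] }.

HB.instance Definition _ := [isSub for psmash_val].
HB.instance Definition _ := [Choice of psmash by <:].
HB.instance Definition _ :=
  GRing.SubChoice_isSubLmodule.Build k _ _ psmash (span_closed psmash_gen).

Lemma psmash_genE a (h : kG) :
  tensor_eval (ga_comul h) (fun h1 h2 : kG => pure_tensor (a * alpha h1 1) h2) =
  [ffun g => h g *: (a * alpha (basis_elt g) 1)].
Proof.
apply/ffunP => x; rewrite ffunE /tensor_eval.
rewrite sum_ffunE (bigD1 (x, x)) //= big1 ?addr0 => [|[u v] /= nuv].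
  rewrite !ffunE eqxx scale1r; congr (_ *: _).
  rewrite /ga_comul sum_ffunE (bigD1 x) //= !ffunE eqxx [_ *: _]mulr1.
  rewrite big1 ?addr0 // => y nyx; rewrite !ffunE xpair_eqE eq_sym (negPf nyx).
  exact: mulr0.
rewrite !ffunE; case: eqP => [xv|_]; last by rewrite scale0r scaler0.
rewrite /ga_comul sum_ffunE big1 ?scale0r // => y _; rewrite !ffunE xpair_eqE.
case: eqP => [uy|_]; last exact: mulr0.
case: eqP => [vy|_]; last exact: mulr0.
by rewrite xv uy vy eqxx in nuv.
Qed.

Lemma psmashP (x : {ffun G -> A}) :
  span psmash_gen x <-> forall g, x g * alpha (basis_elt g) 1 = x g.
Proof.
split=> [|xP].
  move: x; apply: span_ind => [g|c u v uP vP g|_ [a [h ->]] g].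
  - by rewrite ffunE mul0r.
  - by rewrite !ffunE mulrDl -scalerAl uP vP.
  - by rewrite psmash_genE ffunE -scalerAl -mulrA -pactM_basis mulr1.
exists [seq (1, tensor_eval (ga_comul (basis_elt g))
   (fun h1 h2 : kG => pure_tensor (x g * alpha h1 1) h2)) | g <- enum G].
  by move=> _ /mapP[g _ ->] /=; exists (x g), (basis_elt g).
rewrite big_map big_enum /=; apply/ffunP => g; rewrite sum_ffunE.
rewrite (bigD1 g) //= ffunE psmash_genE !ffunE eqxx !scale1r xP.
rewrite big1 ?addr0 // => h /negPf nhg.
by rewrite ffunE psmash_genE !ffunE eq_sym nhg scale0r scaler0.
Qed.

Lemma psmash_valE (x : psmash) g : x g * alpha (basis_elt g) 1 = x g.
Proof. by case: x => x xP /=; move/asboolP/psmashP: xP. Qed.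

Lemma smash_mulE x y n : smash_mul x y n =
  \sum_g x g * alpha (basis_elt g) (y (g^-1 * n)%g).
Proof.
rewrite sum_ffunE; apply: eq_bigr => g _; rewrite sum_ffunE.
rewrite (bigD1 (g^-1 * n)%g) //= ga_comulE ga_basisM !ffunE mulKVg eqxx scale1r.
rewrite big1 ?addr0 // => l nl; rewrite ga_comulE ga_basisM !ffunE.
case: eqP => [nE|_]; last by rewrite scale0r.
by rewrite nE mulKg eqxx in nl.
Qed.

Lemma smash_mulP (x y : psmash) : `[< span psmash_gen (smash_mul x y) >].
Proof.
apply/asboolP/psmashP => n; rewrite smash_mulE mulr_suml; apply: eq_bigr => g _.
rewrite -[in RHS](psmash_valE y) pactM_basis pactA_basis mulKVg.
by rewrite [X in _ = _ * X]mulrA -pactM_basis mulr1 mulrA.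
Qed.

Definition psmash_mul (x y : psmash) : psmash := PSmash (smash_mulP x y).

Lemma psmash_oneP :
  `[< span psmash_gen (pure_tensor 1 (1 : kG)) >].
Proof.
apply/asboolP/psmashP => g; rewrite !ffunE; case: eqP => [->|_].
  by rewrite pact1_basis mulr1.
by rewrite scale0r mul0r.
Qed.

Definition psmash_one : psmash := PSmash psmash_oneP.

Lemma psmash_eqP (x y : psmash) : (forall g, x g = y g) -> x = y.
Proof. by move=> xy; apply/val_inj/ffunP. Qed.

Lemma psmash_mulA : associative psmash_mul.
Proof.
move=> x y z; apply: psmash_eqP => n /=; rewrite !smash_mulE.
under eq_bigr do rewrite smash_mulE pact_sumr mulr_sumr.
under [RHS]eq_bigr do rewrite smash_mulE mulr_suml.
rewrite [RHS]exchange_big; apply: eq_bigr => g _ /=.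
rewrite [RHS](reindex_inj (mulgI g)) /=; apply: eq_bigr => l _.
rewrite pactM_basis pactA_basis mulKg invMg !mulgA.
by rewrite -[in RHS](mulr1 (y l)) pactM_basis !mulrA.
Qed.

Lemma psmash_mul1 : left_id psmash_one psmash_mul.
Proof.
move=> x; apply: psmash_eqP => n; rewrite smash_mulE (bigD1 1%g) //=.
rewrite !ffunE eqxx scale1r mul1r pact1_basis invg1 mul1g big1 ?addr0 // => g.
by move=> /negPf ng; rewrite !ffunE ng scale0r mul0r.
Qed.

Lemma psmash_mul1r : right_id psmash_one psmash_mul.
Proof.
move=> x; apply: psmash_eqP => n; rewrite smash_mulE (bigD1 n) //=.
rewrite !ffunE mulVg eqxx scale1r psmash_valE big1 ?addr0 // => g ng.
rewrite !ffunE; case: eqP => [gE|_]; last by rewrite scale0r pact0r mulr0.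
by rewrite -[n](mulKVg g) gE mulg1 eqxx in ng.
Qed.

Lemma psmash_mulDl : left_distributive psmash_mul +%R.
Proof.
move=> x y z; apply: psmash_eqP => n; rewrite !(ffunE (fun y => _ y + _ y)) !smash_mulE.
by rewrite -big_split; apply: eq_bigr => g _; rewrite ffunE mulrDl.
Qed.

Lemma psmash_mulDr : right_distributive psmash_mul +%R.
Proof.
move=> x y z; apply: psmash_eqP => n; rewrite !(ffunE (fun y => _ y + _ y)) !smash_mulE.
by rewrite -big_split; apply: eq_bigr => g _; rewrite ffunE pactDr mulrDr.
Qed.

Lemma psmash_one_neq0 : psmash_one != 0.
Proof.
apply/eqP => /(congr1 val)/ffunP/(_ 1%g)/eqP.
by rewrite !ffunE eqxx scale1r oner_eq0.
Qed.

HB.instance Definition _ := GRing.Zmodule_isNzRing.Build psmash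
  psmash_mulA psmash_mul1 psmash_mul1r psmash_mulDl psmash_mulDr psmash_one_neq0.

Lemma psmash_scaleAl (c : k) (x y : psmash) : c *: (x * y) = (c *: x) * y.
Proof.
apply: psmash_eqP => n; rewrite (ffunE (fun y => _ *: _ y)) !smash_mulE scaler_sumr.
by apply: eq_bigr => g _; rewrite ffunE scalerAl.
Qed.

Lemma psmash_scaleAr (c : k) (x y : psmash) : c *: (x * y) = x * (c *: y).
Proof.
apply: psmash_eqP => n; rewrite (ffunE (fun y => _ *: _ y)) !smash_mulE scaler_sumr.
by apply: eq_bigr => g _; rewrite ffunE pactZr scalerAr.
Qed.

HB.instance Definition _ := GRing.Lmodule_isLalgebra.Build k psmash psmash_scaleAl.
HB.instance Definition _ := GRing.Lalgebra_isAlgebra.Build k psmash psmash_scaleAr.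

(* The action of kG^* induced by f . (a (x) h) = \sum a (x) h_(1) f(h_(2)). *)
Definition smash_hit (f : kGd) (x : {ffun G -> A}) : {ffun G -> A} :=
  \sum_g tensor_eval (ga_comul (basis_elt g))
    (fun h1 h2 : kG => pure_tensor (x g) (pairing f h2 *: h1)).

Lemma smash_hitE f x g : smash_hit f x g = f g *: x g.
Proof.
rewrite sum_ffunE (bigD1 g) //= ga_comulE pairing_basis !ffunE eqxx.
rewrite [f g *: 1]mulr1 big1 ?addr0 // => h /negPf nhg.
by rewrite ga_comulE !ffunE eq_sym nhg [_ *: 0]mulr0 scale0r.
Qed.

Lemma smash_hitP f (x : psmash) : `[< span psmash_gen (smash_hit f x) >].
Proof.
by apply/asboolP/psmashP => g; rewrite smash_hitE -scalerAl psmash_valE.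
Qed.

Definition psmash_hit f (x : psmash) : psmash := PSmash (smash_hitP f x).

Lemma psmash_hitE f (x : psmash) g : psmash_hit f x g = f g *: x g.
Proof. exact: smash_hitE. Qed.

(* (A # kG) (x) kG^*, on the basis of kG^* dual to G. *)
Definition dsmash : Type := {ffun G -> psmash}.
HB.instance Definition _ := GRing.Lmodule.on dsmash.

Definition dsmash_mul (X Y : dsmash) : dsmash :=
  \sum_s \sum_t tensor_eval (da_comul (basis_elt s))
    (fun f1 f2 : kGd => pure_tensor (X s * psmash_hit f1 (Y t)) (f2 * basis_elt t)).

Definition dsmash_one : dsmash := pure_tensor 1 (1 : kGd).

Lemma psmash_hit_lin f (x y : psmash) c :
  psmash_hit f (c *: x + y) = c *: psmash_hit f x + psmash_hit f y.
Proof.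
apply: psmash_eqP => g; rewrite !(psmash_hitE, ffunE) scalerDr !scalerA.
by rewrite mulrC.
Qed.
Lemma psmash_hit0 f : psmash_hit f 0 = 0.
Proof. by apply: psmash_eqP => g; rewrite psmash_hitE ffunE scaler0. Qed.
Lemma psmash_hitD f : {morph psmash_hit f : x y / x + y}.
Proof. by move=> x y; have := psmash_hit_lin f x y 1; rewrite !scale1r. Qed.
Lemma psmash_hitZ f c x : psmash_hit f (c *: x) = c *: psmash_hit f x.
Proof. by rewrite -[c *: x]addr0 psmash_hit_lin psmash_hit0 addr0. Qed.
Lemma psmash_hit_sum f I (r : seq I) (P : pred I) (F : I -> psmash) :
  psmash_hit f (\sum_(i <- r | P i) F i) = \sum_(i <- r | P i) psmash_hit f (F i).
Proof. exact: (big_morph _ (psmash_hitD f) (psmash_hit0 f)). Qed.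

Lemma dsmash_mulE X Y t : dsmash_mul X Y t =
  \sum_s X s * psmash_hit (basis_elt (s * t^-1)%g) (Y t).
Proof.
rewrite /dsmash_mul sum_ffunE; apply: eq_bigr => s _; rewrite sum_ffunE.
have E u : tensor_eval (da_comul (basis_elt s))
    (fun f1 f2 : kGd => pure_tensor (X s * psmash_hit f1 (Y u)) (f2 * basis_elt u)) t
  = (t == u)%:R *: (X s * psmash_hit (basis_elt (s * t^-1)%g) (Y u)).
  rewrite /tensor_eval sum_ffunE (bigD1 (s * t^-1, t)%g) //= big1 ?addr0.
    rewrite da_comulE ffunE [pure_tensor _ _ _]ffunE dual_algM !ffunE /= mulgKV eqxx scale1r.
    by rewrite eqxx mul1r.
  move=> [v w] nvw; rewrite ffunE [pure_tensor _ _ _]ffunE dual_algM !ffunE /=.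
  case: (t =P w) => [tw|_]; last by rewrite mul0r !(scale0r, scaler0).
  rewrite ga_basisM pairing_basis ffunE.
  case: eqP => [vws|_]; last by rewrite !(scale0r, scaler0).
  by rewrite -tw in vws nvw; rewrite -vws mulgK eqxx in nvw.
rewrite (bigD1 t) //= E eqxx scale1r big1 ?addr0 // => u /negPf nut.
by rewrite E eq_sym nut scale0r.
Qed.

Lemma psmash_mulE (x y : psmash) n :
  (x * y) n = \sum_g x g * alpha (basis_elt g) (y (g^-1 * n)%g).
Proof. exact: smash_mulE. Qed.

Lemma psmash_hit_mul (r s t : G) (y z : psmash) :
  psmash_hit (basis_elt (r * t^-1)%g) (y * psmash_hit (basis_elt (s * t^-1)%g) z)
  = psmash_hit (basis_elt (r * s^-1)%g) y * psmash_hit (basis_elt (s * t^-1)%g) z.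
Proof.
apply: psmash_eqP => n; rewrite psmash_hitE !psmash_mulE scaler_sumr.
apply: eq_bigr => g _; rewrite !psmash_hitE !pactZr !ffunE.
case: (g^-1 * n =P s * t^-1)%g => [gn|_]; last by rewrite !(scale0r, scaler0, mulr0).
have -> : (n == r * t^-1)%g = (g == r * s^-1)%g.
  rewrite -(mulKVg g n) gn -(inj_eq (mulIg (t * s^-1)%g)).
  by rewrite !mulgA !(mulgKV, mulgK).
by rewrite !scale1r scalerAl.
Qed.

Lemma dsmash_mulA : associative dsmash_mul.
Proof.
move=> X Y Z; apply/ffunP => t; rewrite !dsmash_mulE.
under eq_bigr do rewrite psmash_hit_sum mulr_sumr.
under [RHS]eq_bigr do rewrite dsmash_mulE mulr_suml.
rewrite [RHS]exchange_big; apply: eq_bigr => r _ /=; apply: eq_bigr => s _.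
by rewrite psmash_hit_mul mulrA.
Qed.

Lemma dsmash_oneE t : dsmash_one t = 1.
Proof. by rewrite ffunE da_oneE scale1r. Qed.

Lemma dsmash_mul1 : left_id dsmash_one dsmash_mul.
Proof.
move=> X; apply/ffunP => t; rewrite dsmash_mulE.
under eq_bigr do rewrite dsmash_oneE mul1r.
apply: psmash_eqP => n.
rewrite (big_morph (fun x : psmash => x n) (id1 := 0) (op1 := +%R)); first last.
- by rewrite ffunE.
- by move=> x y; rewrite ffunE.
rewrite (bigD1 (n * t)%g) //= psmash_hitE ffunE mulgK eqxx scale1r.
rewrite big1 ?addr0 // => s ns; rewrite psmash_hitE ffunE.
case: eqP => [nE|_]; last by rewrite scale0r.
by rewrite nE mulgKV eqxx in ns.
Qed.

Lemma psmash_hit1 (g : G) : psmash_hit (basis_elt g) 1 = (g == 1%g)%:R *: 1.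
Proof.
apply: psmash_eqP => n; rewrite psmash_hitE !ffunE.
by case: (n =P 1%g) => [->|_]; rewrite ?[1%g == g]eq_sym // !scale0r !scaler0.
Qed.

Lemma dsmash_mul1r : right_id dsmash_one dsmash_mul.
Proof.
move=> X; apply/ffunP => t; rewrite dsmash_mulE.
under eq_bigr do rewrite dsmash_oneE psmash_hit1 -scalerAr mulr1.
rewrite (bigD1 t) //= mulgV eqxx scale1r big1 ?addr0 // => s nst.
case: eqP => [sE|_]; last by rewrite scale0r.
by rewrite -[s](mulgKV t) sE mul1g eqxx in nst.
Qed.

Lemma dsmash_mulDl : left_distributive dsmash_mul +%R.
Proof.
move=> X Y Z; apply/ffunP => t; rewrite (ffunE (fun y => _ y + _ y)) !dsmash_mulE.
by rewrite -big_split; apply: eq_bigr => g _; rewrite ffunE mulrDl.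
Qed.

Lemma dsmash_mulDr : right_distributive dsmash_mul +%R.
Proof.
move=> X Y Z; apply/ffunP => t; rewrite (ffunE (fun y => _ y + _ y)) !dsmash_mulE.
by rewrite -big_split; apply: eq_bigr => g _; rewrite ffunE psmash_hitD mulrDr.
Qed.

Lemma dsmash_one_neq0 : dsmash_one != 0.
Proof. by apply/eqP => /ffunP/(_ 1%g)/eqP; rewrite dsmash_oneE ffunE oner_eq0. Qed.

HB.instance Definition _ := GRing.Zmodule_isNzRing.Build dsmash
  dsmash_mulA dsmash_mul1 dsmash_mul1r dsmash_mulDl dsmash_mulDr dsmash_one_neq0.

Lemma dsmash_scaleAl (c : k) (X Y : dsmash) : c *: (X * Y) = (c *: X) * Y.
Proof.
apply/ffunP => t; rewrite (ffunE (fun y => _ *: _ y)) !dsmash_mulE scaler_sumr.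
by apply: eq_bigr => g _; rewrite ffunE scalerAl.
Qed.

Lemma dsmash_scaleAr (c : k) (X Y : dsmash) : c *: (X * Y) = X * (c *: Y).
Proof.
apply/ffunP => t; rewrite (ffunE (fun y => _ *: _ y)) !dsmash_mulE scaler_sumr.
by apply: eq_bigr => g _; rewrite ffunE psmash_hitZ scalerAr.
Qed.

HB.instance Definition _ := GRing.Lmodule_isLalgebra.Build k dsmash dsmash_scaleAl.
HB.instance Definition _ := GRing.Lalgebra_isAlgebra.Build k dsmash dsmash_scaleAr.

End PartialSmash.

Section Enveloping.
Variables (k : fieldType) (G : finGroupType).
Local Notation kG := (grp_alg k G).

Record is_module_algebra (B : algType k) (act : kG -> B -> B) : Prop := {
  mact_linear_l : forall b, linear (act^~ b);
  mact_linear_r : forall h, linear (act h);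
  mact1 : forall b, act 1 b = b;
  mactA : forall h l b, act h (act l b) = act (h * l) b;
  mactM : forall h b c, act h (b * c) =
    tensor_eval (ga_comul h) (fun h1 h2 : kG => act h1 b * act h2 c);
  mact_unit : forall h, act h 1 = ga_counit h *: 1 }.

Structure module_algebra (B : algType k) := ModuleAlgebra {
  mact :> kG -> B -> B;
  mactP : is_module_algebra mact }.

Variables (A : algType k) (alpha : partial_module_algebra G A).
Variables (B : algType k) (beta : module_algebra B).

Record is_enveloping (phi : A -> B) : Prop := {
  env_linear : linear phi;
  envM : forall a b, phi (a * b) = phi a * phi b;
  env_inj : injective phi;
  env_ideal : forall a b, exists c, phi a * b = phi c;
  env_act : forall (h : kG) a, phi (alpha h a) = phi 1 * beta h (phi a) }.

Structure enveloping := Enveloping {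
  env_map :> A -> B;
  env_mapP : is_enveloping env_map }.

Definition env_unit (phi : enveloping) (g : G) : B := beta (basis_elt g) (phi 1).

Definition env_units_central (phi : enveloping) : Prop :=
  forall g b, env_unit phi g * b = b * env_unit phi g.

Variables (phi : enveloping) (phiC : env_units_central phi).
Local Notation e := (env_unit phi).

Lemma env_unit_idem g : e g * e g = e g.
Proof.
rewrite /env_unit -[in RHS](mulr1 1) (envM (env_mapP phi)).
by rewrite (mactM (mactP beta)) ga_comulE.
Qed.

Lemma env_unit1_neq0 : e 1%g != 0.
Proof.
have phi0 : phi 0 = 0.
  have := env_linear (env_mapP phi) (-1) 0 0.
  by rewrite !scaleN1r !addNr.
rewrite /env_unit (mact1 (mactP beta)); apply/eqP => phi10.
by have /eqP := env_inj (env_mapP phi) (etrans phi10 (esym phi0)); rewrite oner_eq0.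
Qed.

Definition Dhat (g : G) (x : B) : Prop := exists b, x = b * e g.

(* The product of the ideals B 1_g and B 1_h; these are k-subspaces, so the
   k-span of the products of two elements is their additive span.           *)
Definition Dhat_mul (g h : G) : B -> Prop :=
  span (fun z => exists x y, [/\ Dhat g x, Dhat h y & z = x * y]).

Lemma DhatP g x : Dhat g x <-> x * e g = x.
Proof.
split=> [[b ->]|<-]; last by exists x.
by rewrite -mulrA env_unit_idem.
Qed.

Lemma Dhat_mulP g h x : Dhat_mul g h x <-> x * e g = x /\ x * e h = x.
Proof.
split.
  move: x; apply: span_ind => [|c x y [xg xh] [yg yh]|_ [x [y [xP yP ->]]]].
  - by rewrite !mul0r.
  - by rewrite !mulrDl -!scalerAl xg xh yg yh.
  - move/DhatP: xP => xP; move/DhatP: yP => yP.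
    by rewrite -!mulrA yP -phiC mulrA xP.
move=> [xg xh]; apply: span_gen; exists x, (e h).
by split; [apply/DhatP | apply/DhatP; exact: env_unit_idem | rewrite xh].
Qed.

(* Matrix indices are identified with elements of G through [enum_val]. *)
Definition in_smx (X : 'M[B]_#|G|) : Prop :=
  forall i j, Dhat_mul (enum_val i) (enum_val j) (X i j).


Definition smx_one_mx : 'M[B]_#|G| :=
  \sum_i e (enum_val i) *: delta_mx i i.

Definition in_dsum (m : {ffun G -> B}) : Prop := forall g, Dhat g (m g).

Lemma in_smxP (X : 'M[B]_#|G|) : in_smx X <->
  forall i j, X i j * e (enum_val i) = X i j /\ X i j * e (enum_val j) = X i j.
Proof. by split=> XP i j; [apply/Dhat_mulP/XP | apply/Dhat_mulP/XP]. Qed.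

Lemma in_dsumP m : in_dsum m <-> forall g, m g * e g = m g.
Proof. by split=> mP g; [apply/DhatP/mP | apply/DhatP/mP]. Qed.

End Enveloping.

(* The proof that the 1_g are central is a parameter of the types below, since
   their algebra or module structures depend on it.                         *)
Section MatrixAlgebra.
Variables (k : fieldType) (G : finGroupType) (A B : algType k).
Variables (alpha : partial_module_algebra G A) (beta : module_algebra G B).
Variable phi : enveloping alpha beta.
Local Notation e := (env_unit phi).

Record smx (phiC : env_units_central phi) := Smx {
  smx_val :> 'M[B]_#|G|;
  smx_valP : `[< in_smx phi smx_val >] }.

Variable phiC : env_units_central phi.
Local Notation S := (smx phiC).

HB.instance Definition _ := [isSub of S for @smx_val phiC].
HB.instance Definition _ := [Choice of S by <:].

Lemma in_smxE (X : 'M[B]_#|G|) : `[< in_smx phi X >] <-> forall i j,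
  X i j * e (enum_val i) = X i j /\ X i j * e (enum_val j) = X i j.
Proof. by split=> [/asboolP/(in_smxP phiC)|/(in_smxP phiC)/asboolP]. Qed.

Lemma smx_eqP (X Y : S) : (forall i j, X i j = Y i j) -> X = Y.
Proof. by move=> XY; apply/val_inj/matrixP. Qed.

Lemma smx_valE (X : S) i j :
  X i j * e (enum_val i) = X i j /\ X i j * e (enum_val j) = X i j.
Proof. by case: X => X /= /in_smxE. Qed.

Lemma smx_zmod_closed : zmod_closed (fun X => `[< in_smx phi X >]).
Proof.
split=> [|X Y]; rewrite ?unfold_in /=.
  by apply/in_smxE => i j; rewrite mxE !mul0r.
move=> /in_smxE XP /in_smxE YP; apply/in_smxE => i j.
have [X1 X2] := XP i j; have [Y1 Y2] := YP i j.
by rewrite !mxE !mulrDl !mulNr X1 X2 Y1 Y2.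
Qed.

HB.instance Definition _ :=
  GRing.SubChoice_isSubZmodule.Build _ _ S smx_zmod_closed.

Lemma smx_scaleP (c : k) (X : S) : `[< in_smx phi (map_mx ( *:%R c) X) >].
Proof.
apply/in_smxE => i j; have [X1 X2] := smx_valE X i j.
by rewrite !mxE -!scalerAl X1 X2.
Qed.
Definition smx_scale (c : k) (X : S) : S := Smx phiC (smx_scaleP c X).

Lemma smx_scaleA a b X : smx_scale a (smx_scale b X) = smx_scale (a * b) X.
Proof. by apply: smx_eqP => i j; rewrite !mxE scalerA. Qed.
Lemma smx_scale1 : left_id 1 smx_scale.
Proof. by move=> X; apply: smx_eqP => i j; rewrite !mxE scale1r. Qed.
Lemma smx_scaleDr : right_distributive smx_scale +%R.
Proof. by move=> c X Y; apply: smx_eqP => i j; rewrite !mxE scalerDr. Qed.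
Lemma smx_scaleDl X : {morph smx_scale^~ X : a b / a + b}.
Proof. by move=> a b; apply: smx_eqP => i j; rewrite !mxE scalerDl. Qed.

HB.instance Definition _ := GRing.Zmodule_isLmodule.Build k S
  smx_scaleA smx_scale1 smx_scaleDr smx_scaleDl.

Lemma smx_mulP (X Y : S) : `[< in_smx phi (smx_val X *m smx_val Y) >].
Proof.
apply/in_smxE => i j; rewrite !mxE !mulr_suml.
split; apply: eq_bigr => l _.
  by rewrite -mulrA -phiC mulrA; have [-> _] := smx_valE X i l.
by rewrite -mulrA; have [_ ->] := smx_valE Y l j.
Qed.
Definition smx_mul (X Y : S) : S := Smx phiC (smx_mulP X Y).

Lemma smx_one_mxE i j : smx_one_mx phi i j = e (enum_val i) *+ (i == j).
Proof.
rewrite summxE (bigD1 i) //= big1 ?addr0 => [|l nli].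
  by rewrite !mxE eqxx /= [j == i]eq_sym mulr_natr.
by rewrite !mxE eq_sym (negPf nli) mulr0.
Qed.

Lemma smx_oneP : `[< in_smx phi (smx_one_mx phi) >].
Proof.
apply/in_smxE => i j; rewrite smx_one_mxE.
by case: eqP => [->|_]; rewrite ?mul0r // mulr1n env_unit_idem.
Qed.
Definition smx_one : S := Smx phiC smx_oneP.

Lemma smx_mulA : associative smx_mul.
Proof. by move=> X Y Z; apply: val_inj; rewrite /= mulmxA. Qed.
Lemma smx_mul1 : left_id smx_one smx_mul.
Proof.
move=> X; apply: smx_eqP => i j; rewrite mxE (bigD1 i) //= smx_one_mxE eqxx.
rewrite big1 => [|l nli]; last by rewrite smx_one_mxE eq_sym (negPf nli) mul0r.
by rewrite addr0 mulr1n phiC; have [-> _] := smx_valE X i j.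
Qed.
Lemma smx_mul1r : right_id smx_one smx_mul.
Proof.
move=> X; apply: smx_eqP => i j; rewrite mxE (bigD1 j) //= smx_one_mxE eqxx.
rewrite big1 => [|l nlj]; last by rewrite smx_one_mxE (negPf nlj) mulr0.
by rewrite addr0 mulr1n; have [_ ->] := smx_valE X i j.
Qed.
Lemma smx_mulDl : left_distributive smx_mul +%R.
Proof. by move=> X Y Z; apply: val_inj; rewrite /= mulmxDl. Qed.
Lemma smx_mulDr : right_distributive smx_mul +%R.
Proof. by move=> X Y Z; apply: val_inj; rewrite /= mulmxDr. Qed.
Lemma smx_one_neq0 : smx_one != 0.
Proof.
apply/eqP => /(congr1 val)/matrixP/(_ (enum_rank 1%g) (enum_rank 1%g))/eqP.
by rewrite /= smx_one_mxE mxE eqxx enum_rankK mulr1n (negPf (env_unit1_neq0 phi)).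
Qed.

HB.instance Definition _ := GRing.Zmodule_isNzRing.Build S
  smx_mulA smx_mul1 smx_mul1r smx_mulDl smx_mulDr smx_one_neq0.

Lemma smx_scaleAl (c : k) (X Y : S) : c *: (X * Y) = (c *: X) * Y.
Proof.
apply: smx_eqP => i j; rewrite !mxE scaler_sumr.
by apply: eq_bigr => l _; rewrite !mxE scalerAl.
Qed.
Lemma smx_scaleAr (c : k) (X Y : S) : c *: (X * Y) = X * (c *: Y).
Proof.
apply: smx_eqP => i j; rewrite !mxE scaler_sumr.
by apply: eq_bigr => l _; rewrite !mxE scalerAr.
Qed.

HB.instance Definition _ := GRing.Lmodule_isLalgebra.Build k S smx_scaleAl.
HB.instance Definition _ := GRing.Lalgebra_isAlgebra.Build k S smx_scaleAr.

End MatrixAlgebra.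

Section EndAlgebra.
Variables (k : fieldType) (G : finGroupType) (A B : algType k).
Variables (alpha : partial_module_algebra G A) (beta : module_algebra G B).
Variable phi : enveloping alpha beta.
Local Notation e := (env_unit phi).

Record dsum (phiC : env_units_central phi) := Dsum {
  dsum_val :> {ffun G -> B};
  dsum_valP : `[< in_dsum phi dsum_val >] }.

Variable phiC : env_units_central phi.
Local Notation M := (dsum phiC).

HB.instance Definition _ := [isSub of M for @dsum_val phiC].
HB.instance Definition _ := [Choice of M by <:].

Lemma in_dsumE (m : {ffun G -> B}) :
  `[< in_dsum phi m >] <-> forall g, m g * e g = m g.
Proof. by split=> [/asboolP/in_dsumP|/in_dsumP/asboolP]. Qed.

Lemma dsum_valE (m : M) g : m g * e g = m g.
Proof. by case: m => m /= /in_dsumE. Qed.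

Lemma dsum_eqP (m n : M) : (forall g, m g = n g) -> m = n.
Proof. by move=> mn; apply/val_inj/ffunP. Qed.

Lemma dsum_zmod_closed : zmod_closed (fun m => `[< in_dsum phi m >]).
Proof.
split=> [|m n]; rewrite ?unfold_in /=.
  by apply/in_dsumE => g; rewrite ffunE mul0r.
move=> /in_dsumE mP /in_dsumE nP; apply/in_dsumE => g.
by rewrite !ffunE mulrDl mulNr mP nP.
Qed.

HB.instance Definition _ :=
  GRing.SubChoice_isSubZmodule.Build _ _ M dsum_zmod_closed.

(* M is a right B-module, that is, a module over the converse ring B^c: in M,
   b *: m is m b.                                                           *)
Lemma dsum_actP (b : B) (m : M) : `[< in_dsum phi [ffun g => m g * b] >].
Proof. by apply/in_dsumE => g; rewrite ffunE -mulrA -phiC mulrA dsum_valE. Qed.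
Definition dsum_act (b : B^c) (m : M) : M := Dsum phiC (dsum_actP b m).

Lemma dsum_actA a b m : dsum_act a (dsum_act b m) = dsum_act (a * b) m.
Proof. by apply: dsum_eqP => g; rewrite !ffunE -mulrA. Qed.
Lemma dsum_act1 : left_id 1 dsum_act.
Proof. by move=> m; apply: dsum_eqP => g; rewrite !ffunE mulr1. Qed.
Lemma dsum_actDr : right_distributive dsum_act +%R.
Proof. by move=> b m n; apply: dsum_eqP => g; rewrite !ffunE mulrDl. Qed.
Lemma dsum_actDl m : {morph dsum_act^~ m : a b / a + b}.
Proof. by move=> a b; apply: dsum_eqP => g; rewrite !ffunE mulrDr. Qed.

HB.instance Definition _ := GRing.Zmodule_isLmodule.Build B^c M
  dsum_actA dsum_act1 dsum_actDr dsum_actDl.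

Lemma dsum_actE (b : B^c) (m : M) g : (b *: m) g = m g * (b : B).
Proof. exact: ffunE. Qed.

End EndAlgebra.

Section EndB.
Variables (k : fieldType) (G : finGroupType) (A B : algType k).
Variables (alpha : partial_module_algebra G A) (beta : module_algebra G B).
Variable phi : enveloping alpha beta.

Record dsum_end (phiC : env_units_central phi) := DsumEnd {
  dsum_end_val :> dsum phiC -> dsum phiC;
  dsum_end_valP : `[< linear dsum_end_val >] }.

Variable phiC : env_units_central phi.
Local Notation M := (dsum phiC).
Local Notation E := (dsum_end phiC).

HB.instance Definition _ := [isSub of E for @dsum_end_val phiC].
HB.instance Definition _ := [Choice of E by <:].

Lemma dsum_end_linear (f : E) : linear f.
Proof. by case: f => f /= /asboolP. Qed.
Lemma dsum_end_eqP (f g : E) : (forall m, f m = g m) -> f = g.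
Proof. by move=> fg; apply/val_inj/funext. Qed.
Lemma dsum_endD (f : E) : {morph f : x y / x + y}.
Proof. by move=> x y; have := dsum_end_linear f 1 x y; rewrite !scale1r. Qed.
Lemma dsum_end0 (f : E) : f 0 = 0.
Proof. by apply: (addrI (f 0)); rewrite -dsum_endD !addr0. Qed.
Lemma dsum_endZ (f : E) (b : B^c) x : f (b *: x) = b *: f x.
Proof. by rewrite -[b *: x]addr0 dsum_end_linear dsum_end0 addr0. Qed.

Lemma dsum_end_zmod_closed : zmod_closed (fun f : M -> M => `[< linear f >]).
Proof.
split=> [|f g]; rewrite ?unfold_in /=.
  by apply/asboolP => b x y; rewrite addr0 scaler0.
move=> /asboolP fL /asboolP gL; apply/asboolP => b x y.
rewrite -[LHS]/(f (b *: x + y) - g (b *: x + y)) fL gL.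
by rewrite -[(f - g) x]/(f x - g x) -[(f - g) y]/(f y - g y) scalerBr opprD addrACA.
Qed.

HB.instance Definition _ :=
  GRing.SubChoice_isSubZmodule.Build _ _ E dsum_end_zmod_closed.

Lemma dsum_end_addE (f g : E) m : (f + g) m = f m + g m.
Proof. by []. Qed.

(* k acts on M, hence on End_B(M), through k 1_B. *)
Definition dsum_scalar (c : k) : B^c := c%:A : B.

Lemma dsum_scalarC c (b : B^c) (m : M) :
  dsum_scalar c *: (b *: m) = b *: (dsum_scalar c *: m).
Proof.
by apply: dsum_eqP => g; rewrite !dsum_actE -!mulrA mulr_algl mulr_algr.
Qed.

Lemma dsum_end_scaleP (c : k) (f : E) :
  `[< linear (fun m => dsum_scalar c *: f m) >].
Proof.
by apply/asboolP => b x y; rewrite dsum_end_linear scalerDr dsum_scalarC.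
Qed.
Definition dsum_end_scale c (f : E) : E := DsumEnd (dsum_end_scaleP c f).

Lemma dsum_end_scaleA a b f :
  dsum_end_scale a (dsum_end_scale b f) = dsum_end_scale (a * b) f.
Proof.
apply: dsum_end_eqP => m; apply: dsum_eqP => g /=.
by rewrite !ffunE !mulr_algr !scalerA.
Qed.
Lemma dsum_end_scale1 : left_id 1 dsum_end_scale.
Proof. by move=> f; apply: dsum_end_eqP => m; apply: dsum_eqP => g; rewrite ffunE /dsum_scalar scale1r mulr1. Qed.
Lemma dsum_end_scaleDr : right_distributive dsum_end_scale +%R.
Proof. by move=> c f g; apply: dsum_end_eqP => m; exact: (scalerDr (dsum_scalar c)). Qed.
Lemma dsum_end_scaleDl f : {morph dsum_end_scale^~ f : a b / a + b}.
Proof.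
move=> a b; apply: dsum_end_eqP => m; apply: dsum_eqP => g /=.
by rewrite !ffunE /dsum_scalar scalerDl mulrDr.
Qed.

HB.instance Definition _ := GRing.Zmodule_isLmodule.Build k E
  dsum_end_scaleA dsum_end_scale1 dsum_end_scaleDr dsum_end_scaleDl.

Lemma dsum_end_mulP (f g : E) : `[< linear (f \o g) >].
Proof. by apply/asboolP => b x y; rewrite /= !dsum_end_linear. Qed.
Definition dsum_end_mul (f g : E) : E := DsumEnd (dsum_end_mulP f g).

Lemma dsum_end_oneP : `[< linear (@id M) >].
Proof. by apply/asboolP. Qed.
Definition dsum_end_one : E := DsumEnd dsum_end_oneP.

Lemma dsum_end_mulA : associative dsum_end_mul.
Proof. by move=> f g h; apply: dsum_end_eqP. Qed.
Lemma dsum_end_mul1 : left_id dsum_end_one dsum_end_mul.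
Proof. by move=> f; apply: dsum_end_eqP. Qed.
Lemma dsum_end_mul1r : right_id dsum_end_one dsum_end_mul.
Proof. by move=> f; apply: dsum_end_eqP. Qed.
Lemma dsum_end_mulDl : left_distributive dsum_end_mul +%R.
Proof. by move=> f g h; apply: dsum_end_eqP. Qed.
Lemma dsum_end_mulDr : right_distributive dsum_end_mul +%R.
Proof. by move=> f g h; apply: dsum_end_eqP => m; rewrite /= dsum_endD. Qed.

Lemma dsum_unit1P :
  `[< in_dsum phi [ffun g => if g == 1%g then env_unit phi g else 0] >].
Proof.
apply/in_dsumE => g; rewrite ffunE.
by case: ifP => _; rewrite ?mul0r ?env_unit_idem.
Qed.

Lemma dsum_end_one_neq0 : dsum_end_one != 0.
Proof.
apply/eqP => /(congr1 val)/(congr1 (fun f => f (Dsum phiC dsum_unit1P))).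
move=> /(congr1 val)/ffunP/(_ 1%g)/eqP.
by rewrite /= !ffunE eqxx (negPf (env_unit1_neq0 phi)).
Qed.

HB.instance Definition _ := GRing.Zmodule_isNzRing.Build E
  dsum_end_mulA dsum_end_mul1 dsum_end_mul1r dsum_end_mulDl dsum_end_mulDr
  dsum_end_one_neq0.

Lemma dsum_end_scaleAl (c : k) (f g : E) : c *: (f * g) = (c *: f) * g.
Proof. by apply: dsum_end_eqP. Qed.
Lemma dsum_end_scaleAr (c : k) (f g : E) : c *: (f * g) = f * (c *: g).
Proof. by apply: dsum_end_eqP => m; rewrite /= dsum_endZ. Qed.

HB.instance Definition _ := GRing.Lmodule_isLalgebra.Build k E dsum_end_scaleAl.
HB.instance Definition _ := GRing.Lalgebra_isAlgebra.Build k E dsum_end_scaleAr.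

Definition in_summand (g : G) (m : M) : Prop := forall h, h != g -> m h = 0.

(* Hom_B(B 1_h, B 1_g), identified with a set of endomorphisms of M. *)
Definition Dhat_hom (h g : G) (f : E) : Prop :=
  (forall m, in_summand h m -> in_summand g (f m)) /\
  (forall l m, l != h -> in_summand l m -> f m = 0).

End EndB.

Section LAlgebra.
Variables (k : fieldType) (G : finGroupType) (A B : algType k).
Variables (alpha : partial_module_algebra G A) (beta : module_algebra G B).
Variable phi : enveloping alpha beta.

Definition in_lmx (phiC : env_units_central phi)
    (F : 'M[dsum_end phiC]_#|G|) : Prop :=
  forall i j, Dhat_hom (enum_val j) (enum_val i) (F i j).

Record lmx (phiC : env_units_central phi) := Lmx {
  lmx_val :> 'M[dsum_end phiC]_#|G|;
  lmx_valP : `[< in_lmx lmx_val >] }.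

Variable phiC : env_units_central phi.
Local Notation M := (dsum phiC).
Local Notation E := (dsum_end phiC).
Local Notation L := (lmx phiC).

HB.instance Definition _ := [isSub of L for @lmx_val phiC].
HB.instance Definition _ := [Choice of L by <:].

Lemma lmx_eqP (X Y : L) : (forall i j, X i j = Y i j) -> X = Y.
Proof. by move=> XY; apply/val_inj/matrixP. Qed.
Lemma lmx_valE (X : L) i j : Dhat_hom (enum_val j) (enum_val i) (X i j).
Proof. by case: X => X /= /asboolP. Qed.

Lemma in_summand0 g : in_summand g (0 : M).
Proof. by move=> h _; rewrite ffunE. Qed.
Lemma in_summandB g (m n : M) :
  in_summand g m -> in_summand g n -> in_summand g (m - n).
Proof. by move=> mP nP h hg; rewrite !ffunE mP // nP // subr0. Qed.
Lemma in_summandD g (m n : M) :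
  in_summand g m -> in_summand g n -> in_summand g (m + n).
Proof. by move=> mP nP h hg; rewrite !ffunE mP // nP // addr0. Qed.
Lemma in_summandZ g (b : B^c) (m : M) :
  in_summand g m -> in_summand g (b *: m).
Proof. by move=> mP h hg; rewrite ffunE mP // mul0r. Qed.

Lemma Dhat_hom0 h g : Dhat_hom h g (0 : E).
Proof. by split=> // m _; exact: in_summand0. Qed.
Lemma Dhat_homB h g (f1 f2 : E) :
  Dhat_hom h g f1 -> Dhat_hom h g f2 -> Dhat_hom h g (f1 - f2).
Proof.
move=> [f1P f1Z] [f2P f2Z]; split=> [m mh|l m lh ml].
  by apply: in_summandB; [apply: f1P | apply: f2P].
by rewrite -[LHS]/(f1 m - f2 m) (f1Z l) // (f2Z l) // subr0.
Qed.
Lemma Dhat_homD h g (f1 f2 : E) :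
  Dhat_hom h g f1 -> Dhat_hom h g f2 -> Dhat_hom h g (f1 + f2).
Proof.
move=> f1P f2P; rewrite -[f2]opprK -[- f2]sub0r.
by do ?apply: Dhat_homB => //; exact: Dhat_hom0.
Qed.
Lemma Dhat_homZ h g c (f : E) : Dhat_hom h g f -> Dhat_hom h g (c *: f).
Proof.
move=> [fP fZ]; split=> [m mh|l m lh ml].
  by apply: in_summandZ; apply: fP.
by rewrite -[LHS]/(dsum_scalar B c *: f m) (fZ l) // scaler0.
Qed.
Lemma Dhat_homM h l g (f1 f2 : E) :
  Dhat_hom l g f1 -> Dhat_hom h l f2 -> Dhat_hom h g (f1 * f2).
Proof.
move=> [f1P f1Z] [f2P f2Z]; split=> [m mh|l' m lh ml].
  by apply: f1P; apply: f2P.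
by rewrite -[LHS]/(f1 (f2 m)) (f2Z l') // dsum_end0.
Qed.

Lemma lmx_zmod_closed :
  zmod_closed (fun F : 'M[E]_#|G| => `[< in_lmx F >]).
Proof.
split=> [|X Y]; rewrite ?unfold_in /=.
  by apply/asboolP => i j; rewrite mxE; exact: Dhat_hom0.
move=> /asboolP XP /asboolP YP; apply/asboolP => i j; rewrite !mxE.
exact: Dhat_homB.
Qed.

HB.instance Definition _ :=
  GRing.SubChoice_isSubZmodule.Build _ _ L lmx_zmod_closed.

Lemma lmx_scaleP (c : k) (X : L) : `[< in_lmx (map_mx ( *:%R c) X) >].
Proof.
by apply/asboolP => i j; rewrite mxE; apply/Dhat_homZ/lmx_valE.
Qed.
Definition lmx_scale (c : k) (X : L) : L := Lmx (lmx_scaleP c X).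

Lemma lmx_scaleA a b X : lmx_scale a (lmx_scale b X) = lmx_scale (a * b) X.
Proof. by apply: lmx_eqP => i j; rewrite !mxE scalerA. Qed.
Lemma lmx_scale1 : left_id 1 lmx_scale.
Proof. by move=> X; apply: lmx_eqP => i j; rewrite !mxE scale1r. Qed.
Lemma lmx_scaleDr : right_distributive lmx_scale +%R.
Proof. by move=> c X Y; apply: lmx_eqP => i j; rewrite !mxE scalerDr. Qed.
Lemma lmx_scaleDl X : {morph lmx_scale^~ X : a b / a + b}.
Proof. by move=> a b; apply: lmx_eqP => i j; rewrite !mxE scalerDl. Qed.

HB.instance Definition _ := GRing.Zmodule_isLmodule.Build k L
  lmx_scaleA lmx_scale1 lmx_scaleDr lmx_scaleDl.

Lemma lmx_mulP (X Y : L) : `[< in_lmx (lmx_val X *m lmx_val Y) >].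
Proof.
apply/asboolP => i j; rewrite mxE.
apply: (big_ind (Dhat_hom (enum_val j) (enum_val i))) => [|f1 f2|l _].
- exact: Dhat_hom0.
- exact: Dhat_homD.
- exact: Dhat_homM (lmx_valE X i l) (lmx_valE Y l j).
Qed.
Definition lmx_mul (X Y : L) : L := Lmx (lmx_mulP X Y).

Lemma dsum_projP (g : G) (m : M) :
  `[< in_dsum phi [ffun h => if h == g then m h else 0] >].
Proof.
by apply/in_dsumE => h; rewrite ffunE; case: ifP; rewrite ?mul0r ?dsum_valE.
Qed.
Lemma dsum_proj_linear (g : G) :
  `[< linear (fun m : M => Dsum phiC (dsum_projP g m)) >].
Proof.
apply/asboolP => b x y; apply: dsum_eqP => h; rewrite !ffunE.
by case: ifP; rewrite ?mul0r ?addr0.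
Qed.
Definition dsum_proj (g : G) : E := DsumEnd (dsum_proj_linear g).

Lemma dsum_projE g (m : M) h : dsum_proj g m h = if h == g then m h else 0.
Proof. exact: ffunE. Qed.

Definition lmx_one_mx : 'M[E]_#|G| :=
  \matrix_(i, j) if i == j then dsum_proj (enum_val i) else 0.

Lemma lmx_oneP : `[< in_lmx lmx_one_mx >].
Proof.
apply/asboolP => i j; rewrite mxE; case: eqP => [->|_]; last exact: Dhat_hom0.
split=> [m mj h /negPf hj|l m lj ml]; first by rewrite dsum_projE hj.
apply: dsum_eqP => h; rewrite dsum_projE [RHS]ffunE.
by case: eqP => // ->; apply: ml; rewrite eq_sym.
Qed.
Definition lmx_one : L := Lmx lmx_oneP.

Lemma dsum_proj_compl h (m : M) :
  m - dsum_proj h m = \sum_(x | x != h) dsum_proj x m.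
Proof.
apply: dsum_eqP => y.
rewrite (big_morph (fun x : M => x y) (id1 := 0) (op1 := +%R)); first last.
- by rewrite ffunE.
- by move=> u v; rewrite ffunE.
rewrite !ffunE; case: eqP => [->|/eqP yh].
  by rewrite subrr big1 // => x xh; rewrite dsum_projE eq_sym (negPf xh).
rewrite subr0 (bigD1 y) //= dsum_projE eqxx big1 ?addr0 // => x /andP[_ xy].
by rewrite dsum_projE eq_sym (negPf xy).
Qed.

Lemma dsum_proj_summand g (m : M) : in_summand g (dsum_proj g m).
Proof. by move=> h /negPf hg; rewrite dsum_projE hg. Qed.

Lemma Dhat_hom_projr h g (f : E) : Dhat_hom h g f -> f * dsum_proj h = f.
Proof.
move=> [_ fZ]; apply: dsum_end_eqP => m; rewrite -[LHS]/(f (dsum_proj h m)).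
rewrite -[m in RHS](subrK (dsum_proj h m)) dsum_endD dsum_proj_compl.
rewrite (big_morph f (dsum_endD f) (dsum_end0 f)) big1 ?add0r // => x xh.
by apply: (fZ x) => //; exact: dsum_proj_summand.
Qed.

Lemma Dhat_hom_projl h g (f : E) : Dhat_hom h g f -> dsum_proj g * f = f.
Proof.
move=> fH; rewrite -(Dhat_hom_projr fH); have [fP _] := fH.
apply: dsum_end_eqP => m; apply: dsum_eqP => l.
rewrite -[LHS]/(dsum_proj g (f (dsum_proj h m)) l) dsum_projE.
by case: eqP => // /eqP lg; rewrite [RHS](fP _ (@dsum_proj_summand h m) l lg).
Qed.

Lemma lmx_mulA : associative lmx_mul.
Proof. by move=> X Y Z; apply: val_inj; rewrite /= mulmxA. Qed.
Lemma lmx_mul1 : left_id lmx_one lmx_mul.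
Proof.
move=> X; apply: lmx_eqP => i j; rewrite mxE (bigD1 i) //= mxE eqxx.
rewrite big1 => [|l nli]; last by rewrite mxE eq_sym (negPf nli) mul0r.
by rewrite addr0; apply: Dhat_hom_projl (lmx_valE X i j).
Qed.
Lemma lmx_mul1r : right_id lmx_one lmx_mul.
Proof.
move=> X; apply: lmx_eqP => i j; rewrite mxE (bigD1 j) //= mxE eqxx.
rewrite big1 => [|l nlj]; last by rewrite mxE (negPf nlj) mulr0.
by rewrite addr0; apply: Dhat_hom_projr (lmx_valE X i j).
Qed.
Lemma lmx_mulDl : left_distributive lmx_mul +%R.
Proof. by move=> X Y Z; apply: val_inj; rewrite /= mulmxDl. Qed.
Lemma lmx_mulDr : right_distributive lmx_mul +%R.
Proof. by move=> X Y Z; apply: val_inj; rewrite /= mulmxDr. Qed.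
Lemma lmx_one_neq0 : lmx_one != 0.
Proof.
apply/eqP => /(congr1 val)/matrixP/(_ (enum_rank 1%g) (enum_rank 1%g)).
rewrite !mxE eqxx enum_rankK => /(congr1 val).
move=> /(congr1 (fun f => f (Dsum phiC (dsum_unit1P phi)))).
move=> /(congr1 val)/ffunP/(_ 1%g)/eqP.
by rewrite /= !ffunE eqxx (negPf (env_unit1_neq0 phi)).
Qed.

HB.instance Definition _ := GRing.Zmodule_isNzRing.Build L
  lmx_mulA lmx_mul1 lmx_mul1r lmx_mulDl lmx_mulDr lmx_one_neq0.

Lemma lmx_scaleAl (c : k) (X Y : L) : c *: (X * Y) = (c *: X) * Y.
Proof.
apply: lmx_eqP => i j; rewrite !mxE scaler_sumr.
by apply: eq_bigr => l _; rewrite !mxE scalerAl.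
Qed.
Lemma lmx_scaleAr (c : k) (X Y : L) : c *: (X * Y) = X * (c *: Y).
Proof.
apply: lmx_eqP => i j; rewrite !mxE scaler_sumr.
by apply: eq_bigr => l _; rewrite !mxE scalerAr.
Qed.

HB.instance Definition _ := GRing.Lmodule_isLalgebra.Build k L lmx_scaleAl.
HB.instance Definition _ := GRing.Lalgebra_isAlgebra.Build k L lmx_scaleAr.

End LAlgebra.

(* Main.v *)
(* On A the partial action is g . a = 1_1 (g |> a), and for the basis (p_t) of
   kG^* dual to G the product of two elements of (A # kG) # kG^* matches
   (a # g) # p_t with (b # h) # p_s only when t = h s. Hence
   (a # g) # p_t |-> (u |> a) E_{u,v}, where v = t^-1 and u = (g t)^-1,
   is multiplicative. It maps onto S(M): translation by u^-1 takes
   B 1_u 1_v to B 1_1 1_g = A (g . 1_A), because g = u^-1 v.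
   The entry b in B 1_u 1_v corresponds to left multiplication by b, a right
   B-linear map from B 1_v to B 1_u, recovered as the value at the generator
   1_v. Finally, an endomorphism of M is the sum of its matrix entries, which
   are cut out by the projections onto the summands.                         *)
Require Import Defs.
From HB Require Import structures.
From mathcomp Require Import all_boot all_order all_algebra all_fingroup.
From mathcomp Require Import boolp.

Set Implicit Arguments.
Unset Strict Implicit.
Unset Printing Implicit Defensive.

Import GRing.Theory.
Local Open Scope ring_scope.

Lemma alg_isomorphicP (k : fieldType) (X Y : algType k) (f : X -> Y) :
  linear f -> f 1 = 1 -> {morph f : x y / x * y} -> injective f ->
  (forall y, exists x, f x = y) -> alg_isomorphic X Y.
Proof.
move=> fL f1 fM fI fS.
pose lL := GRing.isLinear.Build k X Y *:%R f fL.
pose lM := GRing.isMonoidMorphism.Build X Y f (conj f1 fM).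
pose F : {lrmorphism X -> Y} := HB.pack f lL lM.
exists F; exists (fun y => projT1 (cid (fS y))) => [x|y].
  by apply: fI; case: cid.
by case: cid.
Qed.

(** * The double smash product and S(M) *)

Section PartialSmashMatrix.
Variables (k : fieldType) (G : finGroupType) (A B : algType k).
Variables (alpha : partial_module_algebra G A) (beta : module_algebra G B).
Variable phi : enveloping alpha beta.
Local Notation e := (env_unit phi).
Local Notation ba g := (beta (basis_elt g)).

Lemma mact_basisM (g : G) b c : ba g (b * c) = ba g b * ba g c.
Proof. by rewrite (mactM (mactP beta)) ga_comulE. Qed.

Lemma mact_basisA (g h : G) b : ba g (ba h b) = ba (g * h)%g b.
Proof. by rewrite (mactA (mactP beta)) ga_basisM. Qed.

Lemma mact_basis1 b : ba 1%g b = b.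
Proof. exact: (mact1 (mactP beta)). Qed.

Lemma mact_basisK (g : G) : cancel (beta (basis_elt g)) (ba g^-1%g).
Proof. by move=> b; rewrite mact_basisA mulVg mact_basis1. Qed.

Lemma mact0 h : beta h 0 = 0.
Proof. by have := mact_linear_r (mactP beta) h (-1) 0 0; rewrite !scaleN1r !addNr. Qed.

Lemma mactD h : {morph beta h : b c / b + c}.
Proof. by move=> b c; rewrite -[b]scale1r (mact_linear_r (mactP beta)) !scale1r. Qed.

Lemma mact_sum h I (r : seq I) (P : pred I) (F : I -> B) :
  beta h (\sum_(i <- r | P i) F i) = \sum_(i <- r | P i) beta h (F i).
Proof. exact: (big_morph (beta h) (mactD h) (mact0 h)). Qed.

Lemma env_map0 : phi 0 = 0.
Proof. by have := env_linear (env_mapP phi) (-1) 0 0; rewrite !scaleN1r !addNr. Qed.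

Lemma env_mapD : {morph phi : a b / a + b}.
Proof. by move=> a b; rewrite -[a]scale1r (env_linear (env_mapP phi)) !scale1r. Qed.

Lemma env_map_sum I (r : seq I) (P : pred I) (F : I -> A) :
  phi (\sum_(i <- r | P i) F i) = \sum_(i <- r | P i) phi (F i).
Proof. exact: (big_morph phi env_mapD env_map0). Qed.

Lemma env_unit1 : e 1%g = phi 1.
Proof. exact: mact_basis1. Qed.

Lemma mact_env_unit (g h : G) : ba g (e h) = e (g * h)%g.
Proof. exact: mact_basisA. Qed.

Lemma env_map_act (g : G) a : phi (alpha (basis_elt g) a) = e 1%g * ba g (phi a).
Proof. by rewrite (env_act (env_mapP phi)) env_unit1. Qed.

Lemma env_map_unitr a : phi a * e 1%g = phi a.
Proof. by rewrite env_unit1 -(envM (env_mapP phi)) mulr1. Qed.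

(** [phi 1] lies in the right ideal phi(A). With [env_map_unitr] and centrality this identifies
    phi(A) with B 1_1. *)
Lemma env_map_onto b : exists a, phi a = e 1%g * b.
Proof. by rewrite env_unit1; have [a ->] := env_ideal (env_mapP phi) 1 b; exists a. Qed.

Hypothesis phiC : env_units_central phi.

(** Solving v = t^-1 and u = (g t)^-1 gives t = v^-1 and g = u^-1 v, so an entry reads a single
    coefficient of [X]. *)
Definition dsmash_entry (X : dsmash alpha) (u v : G) : B :=
  ba u (phi (X v^-1%g (u^-1 * v)%g)).

(** The coefficient absorbs 1_1 since it comes from A, and 1_g since it belongs to the partial smash
    product. Translation by u turns these idempotents into 1_u and 1_(u g) = 1_v. *)
Lemma dsmash_entryP X u v : dsmash_entry X u v * e u = dsmash_entry X u v /\
  dsmash_entry X u v * e v = dsmash_entry X u v.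
Proof.
rewrite /dsmash_entry; split; first by rewrite -mact_basisM -env_unit1 env_map_unitr.
rewrite -[in e v](mulKVg u v) -mact_env_unit -mact_basisM; congr (beta _ _).
rewrite -[in RHS]psmash_valE (envM (env_mapP phi)) env_map_act.
by rewrite mulrA env_map_unitr.
Qed.

Lemma dsmash_smxP X : `[< in_smx phi (\matrix_(i, j)
  dsmash_entry X (enum_val i) (enum_val j)) >].
Proof. by apply/(in_smxE phiC) => i j; rewrite mxE; exact: dsmash_entryP. Qed.

Definition dsmash_smx (X : dsmash alpha) : smx phiC := Smx phiC (dsmash_smxP X).

Lemma dsmash_smx_linear : linear dsmash_smx.
Proof.
move=> c X Y; apply: smx_eqP => i j; rewrite !mxE /dsmash_entry !ffunE.
by rewrite (env_linear (env_mapP phi)) (mact_linear_r (mactP beta)).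
Qed.

Lemma dsmash_smx1 : dsmash_smx 1 = 1.
Proof.
apply: smx_eqP => i j; rewrite smx_one_mxE mxE /dsmash_entry.
rewrite -[1]/(dsmash_one alpha) dsmash_oneE !ffunE -(inj_eq (mulgI (enum_val i))).
rewrite mulKVg mulg1 (inj_eq enum_val_inj) eq_sym.
by case: eqP => _; rewrite ?scale1r // scale0r env_map0 mact0.
Qed.

Lemma dsmashM_entry X Y (u v : G) : dsmash_entry (X * Y) u v =
  \sum_w dsmash_entry X u w * dsmash_entry Y w v.
Proof.
rewrite {1}/dsmash_entry -[X * Y]/(dsmash_mul X Y) dsmash_mulE.
rewrite (big_morph (fun x : psmash alpha => x (u^-1 * v)%g)
  (id1 := 0) (op1 := +%R)) ?ffunE //; last by move=> x y; rewrite ffunE.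
(* The dual basis index s becomes w^-1, so that w is the intermediate matrix index. *)
rewrite env_map_sum mact_sum (reindex_inj invg_inj) /=; apply: eq_bigr => w _.
(* The dual basis element at w^-1 v kills every term but the one with g^-1 u^-1 v = w^-1 v, that is
   g = u^-1 w. *)
rewrite smash_mulE (bigD1 (u^-1 * w)%g) //= big1 ?addr0.
  rewrite smash_hitE ffunE invMg !invgK mulgA mulgK eqxx scale1r.
  (* The factor 1_1 produced by the partial action is absorbed by the left coefficient, which leaves
     the global action. *)
  rewrite (envM (env_mapP phi)) env_map_act mulrA env_map_unitr mact_basisM.
  by rewrite mact_basisA mulKVg.
move=> g ng; rewrite smash_hitE ffunE invgK.
case: eqP => [E|_]; last by rewrite scale0r pact0r mulr0.
case/eqP: ng; apply: (mulIg (w^-1 * v)%g).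
by rewrite -E mulKVg E -!mulgA mulKVg.
Qed.

Lemma dsmash_smxM : {morph dsmash_smx : X Y / X * Y}.
Proof.
move=> X Y; apply: smx_eqP => i j; rewrite !mxE dsmashM_entry.
rewrite (reindex_onto enum_val enum_rank) => [|w _]; last exact: enum_rankK.
by apply: eq_big => [l|l _]; rewrite ?enum_valK ?eqxx // !mxE.
Qed.

Lemma dsmash_smxE X u v :
  dsmash_smx X (enum_rank u) (enum_rank v) = dsmash_entry X u v.
Proof. by rewrite mxE !enum_rankK. Qed.

Lemma dsmash_smx_inj : injective dsmash_smx.
Proof.
move=> X Y XY; apply/ffunP => t; apply: psmash_eqP => g.
(* This is the one entry that holds the coefficient of g in [X t]; translation and [phi] are both
   injective. *)
have := dsmash_smxE X (t^-1 * g^-1)%g t^-1%g.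
rewrite XY dsmash_smxE /dsmash_entry invMg !invgK mulgK.
by move=> /(can_inj (@mact_basisK _))/(env_inj (env_mapP phi)).
Qed.

Lemma dsmash_smx_onto (Z : smx phiC) : exists X, dsmash_smx X = Z.
Proof.
pose z u v := Z (enum_rank u) (enum_rank v).
have zP u v : z u v * e u = z u v /\ z u v * e v = z u v.
  by have := smx_valE Z (enum_rank u) (enum_rank v); rewrite !enum_rankK.
(* The candidate coefficient: the entry at u = (g t)^-1 and v = t^-1, translated back by u^-1 = g
   t. *)
pose w t g := ba (g * t)%g (z (t^-1 * g^-1)%g t^-1%g).
have w1 t g : w t g * e 1%g = w t g.
  rewrite /w -[in e 1%g](mulgV (g * t)%g) -mact_env_unit -mact_basisM invMg.
  by have [-> _] := zP (t^-1 * g^-1)%g t^-1%g.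
have wg t g : w t g * e g = w t g.
  rewrite /w -[in e g](mulgK t g) -mact_env_unit -mact_basisM.
  by have [_ ->] := zP (t^-1 * g^-1)%g t^-1%g.
have phi_w t g : exists a, phi a = w t g.
  by have [a aE] := env_map_onto (w t g); exists a; rewrite aE phiC w1.
pose x t : {ffun G -> A} := [ffun g => projT1 (cid (phi_w t g))].
have xE t g : phi (x t g) = w t g by rewrite ffunE; case: cid.
(* Absorbing 1_g is, through [phi], the membership criterion of [psmashP]. *)
have xP t : `[< Defs.span (psmash_gen alpha) (x t) >].
  apply/asboolP/psmashP => g; apply: (env_inj (env_mapP phi)).
  by rewrite (envM (env_mapP phi)) env_map_act mulrA env_map_unitr xE wg.
exists [ffun t => PSmash (xP t)]; apply: smx_eqP => i j.
rewrite mxE /dsmash_entry ffunE xE /w mulgK mact_basisA mulgV mact_basis1.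
by rewrite /z invMg !invgK mulKVg !enum_valK.
Qed.

Lemma dsmash_smx_iso : alg_isomorphic (dsmash alpha) (smx phiC).
Proof.
exact: alg_isomorphicP dsmash_smx_linear dsmash_smx1 dsmash_smxM
  dsmash_smx_inj dsmash_smx_onto.
Qed.

End PartialSmashMatrix.

(** * Entries of S(M) as homomorphisms between summands *)

Section MatrixEnd.
Variables (k : fieldType) (G : finGroupType) (A B : algType k).
Variables (alpha : partial_module_algebra G A) (beta : module_algebra G B).
Variables (phi : enveloping alpha beta) (phiC : env_units_central phi).
Local Notation e := (env_unit phi).
Local Notation M := (dsum phiC).
Local Notation E := (dsum_end phiC).
Local Notation L := (lmx phiC).
Local Notation S := (smx phiC).

Lemma Dhat_elt_dsumP (g : G) (b : B) : b * e g = b ->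
  `[< in_dsum phi [ffun h => if h == g then b else 0] >].
Proof.
move=> bg; apply/in_dsumE => h; rewrite ffunE.
by case: eqP => [->|_] //; rewrite mul0r.
Qed.

Definition dsum_inj (g : G) (b : B) (bg : b * e g = b) : M :=
  Dsum phiC (Dhat_elt_dsumP bg).

Lemma dsum_injE g b (bg : b * e g = b) h :
  dsum_inj bg h = if h == g then b else 0.
Proof. exact: ffunE. Qed.

(** Centrality moves the idempotent past [m] to the entry, which absorbs it. Left multiplication by
    the entry thus lands in the summand of row i. *)
Lemma smx_entry_summandP (X : S) i j (m : M) :
  X i j * m (enum_val j) * e (enum_val i) = X i j * m (enum_val j).
Proof. by rewrite -mulrA -phiC mulrA; have [-> _] := smx_valE X i j. Qed.

Lemma smx_entry_linear (X : S) i j :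
  `[< linear (fun m : M => dsum_inj (smx_entry_summandP X i j m)) >].
Proof.
apply/asboolP => b x y; apply: dsum_eqP => g.
rewrite !(ffunE, dsum_injE); case: eqP => _; last by rewrite mul0r addr0.
by rewrite mulrDr mulrA.
Qed.

Definition smx_entry_end (X : S) i j : E := DsumEnd (smx_entry_linear X i j).

Lemma smx_entry_endE (X : S) i j m g :
  smx_entry_end X i j m g = if g == enum_val i then X i j * m (enum_val j) else 0.
Proof. exact: dsum_injE. Qed.

Lemma smx_lmxP (X : S) : `[< in_lmx (\matrix_(i, j) smx_entry_end X i j) >].
Proof.
apply/asboolP => i j; rewrite mxE; split=> [m _ h /negPf hi|l m lj ml].
  by rewrite smx_entry_endE hi.
apply: dsum_eqP => g; rewrite smx_entry_endE ml 1?eq_sym // mulr0.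
by rewrite [RHS]ffunE if_same.
Qed.

Definition smx_lmx (X : S) : L := Lmx (smx_lmxP X).

(** The entry at (i, j) takes values in the summand of i, so the other components vanish and need no
    comparison. *)
Lemma lmx_entry_eqP (F1 F2 : L) :
  (forall i j m, F1 i j m (enum_val i) = F2 i j m (enum_val i)) -> F1 = F2.
Proof.
move=> F12; apply: lmx_eqP => i j; apply: dsum_end_eqP => m.
rewrite -(Dhat_hom_projl (lmx_valE F1 i j)) -(Dhat_hom_projl (lmx_valE F2 i j)).
by apply: dsum_eqP => g; rewrite !dsum_projE; case: eqP => // ->.
Qed.

Lemma smx_lmxE X i j m : smx_lmx X i j m (enum_val i) = X i j * m (enum_val j).
Proof. by rewrite mxE smx_entry_endE eqxx. Qed.

Lemma dsum_sumE I (r : seq I) (P : pred I) (F : I -> M) g :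
  (\sum_(i <- r | P i) F i) g = \sum_(i <- r | P i) F i g.
Proof.
apply: (big_morph (fun m : M => m g)) => [x y|]; exact: ffunE.
Qed.

Lemma dsum_end_sumE I (r : seq I) (P : pred I) (F : I -> E) m :
  (\sum_(i <- r | P i) F i) m = \sum_(i <- r | P i) F i m.
Proof. exact: (big_morph (fun f : E => f m)). Qed.

Lemma smx_lmx_linear : linear smx_lmx.
Proof.
move=> c X Y; apply: lmx_entry_eqP => i j m; rewrite smx_lmxE !mxE.
rewrite !ffunE !eqxx mulrDl /dsum_scalar mulr_algr.
by rewrite scalerAl.
Qed.

Lemma smx_lmx1 : smx_lmx 1 = 1.
Proof.
apply: lmx_entry_eqP => i j m; rewrite smx_lmxE smx_one_mxE mxE.
case: eqP => [<-|_]; last by rewrite mul0r [RHS]ffunE.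
by rewrite dsum_projE eqxx phiC dsum_valE.
Qed.

Lemma smx_lmxM : {morph smx_lmx : X Y / X * Y}.
Proof.
move=> X Y; apply: lmx_entry_eqP => i j m; rewrite smx_lmxE !mxE.
rewrite dsum_end_sumE dsum_sumE mulr_suml; apply: eq_bigr => l _.
by rewrite -[RHS]/(smx_lmx X i l (smx_lmx Y l j m) (enum_val i)) !smx_lmxE mulrA.
Qed.

Local Notation u g := (dsum_inj (env_unit_idem phi g)).

Lemma smx_lmx_inj : injective smx_lmx.
Proof.
move=> X Y XY; apply: smx_eqP => i j.
have := smx_lmxE X i j (u (enum_val j)); rewrite XY smx_lmxE dsum_injE eqxx.
by have [_ ->] := smx_valE X i j; have [_ ->] := smx_valE Y i j.
Qed.

(** By centrality m_g = 1_g m_g: each summand is cyclic over B with generator 1_g, so a right linear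
    map on it is determined by its value there. *)
Lemma dsum_proj_unitZ (g : G) (m : M) : dsum_proj phiC g m = (m g : B^c) *: u g.
Proof.
apply: dsum_eqP => h; rewrite dsum_actE dsum_injE dsum_projE.
by case: eqP => [->|_]; rewrite ?mul0r // phiC dsum_valE.
Qed.

Lemma smx_lmx_onto (F : L) : exists X, smx_lmx X = F.
Proof.
pose X := \matrix_(i, j) F i j (u (enum_val j)) (enum_val i).
have XP : `[< in_smx phi X >].
  apply/(in_smxE phiC) => i j; rewrite mxE dsum_valE; split=> //.
  (* By right linearity F(1_v) 1_v = F(1_v 1_v) = F(1_v), where v is the group element of column
     j. *)
  rewrite -[LHS]dsum_actE -dsum_endZ; congr (F i j _ _); apply: dsum_eqP => h.
  by rewrite dsum_actE dsum_injE; case: eqP; rewrite ?mul0r ?env_unit_idem.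
exists (Smx phiC XP); apply: lmx_entry_eqP => i j m; rewrite smx_lmxE mxE.
(* F(1_v) m_v = F(1_v m_v) is the value of F at the projection of [m], and F ignores the other
   summands. *)
rewrite -[LHS]dsum_actE -dsum_endZ -dsum_proj_unitZ.
by rewrite -[in RHS](Dhat_hom_projr (lmx_valE F i j)).
Qed.

Lemma smx_lmx_iso : alg_isomorphic S L.
Proof.
exact: alg_isomorphicP smx_lmx_linear smx_lmx1 smx_lmxM smx_lmx_inj smx_lmx_onto.
Qed.

(** * Peirce decomposition of the endomorphism algebra of M *)

Lemma dsum_proj_sum : \sum_(i < #|G|) dsum_proj phiC (enum_val i) = 1.
Proof.
apply: dsum_end_eqP => m; apply: dsum_eqP => g.
rewrite dsum_end_sumE dsum_sumE (bigD1 (enum_rank g)) //= enum_rankK.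
rewrite dsum_projE eqxx big1 ?addr0 // => i; rewrite dsum_projE => ig.
by case: (g =P enum_val i) ig => [->|] //; rewrite enum_valK eqxx.
Qed.

(** With [dsum_proj_sum], the projections form a complete system of orthogonal idempotents. *)
Lemma dsum_projM (g h : G) :
  dsum_proj phiC g * dsum_proj phiC h = if g == h then dsum_proj phiC g else 0.
Proof.
apply: dsum_end_eqP => m; apply: dsum_eqP => l.
rewrite -[LHS]/(dsum_proj phiC g (dsum_proj phiC h m) l) !dsum_projE.
case: (g =P h) => [<-|/eqP/negPf gh].
  by rewrite dsum_projE; case: eqP.
by rewrite [RHS]ffunE; case: eqP => // ->; rewrite gh.
Qed.

Lemma Dhat_hom_proj (f : E) (g h : G) :
  Dhat_hom h g (dsum_proj phiC g * f * dsum_proj phiC h).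
Proof.
split=> [m _|l m lh ml]; first exact: dsum_proj_summand.
rewrite -[LHS]/((dsum_proj phiC g * f) (dsum_proj phiC h m)).
suff -> : dsum_proj phiC h m = 0 by exact: dsum_end0.
apply: dsum_eqP => x; rewrite dsum_projE [RHS]ffunE.
by case: eqP => // ->; apply: ml; rewrite eq_sym.
Qed.

Definition lmx_sum (F : L) : E := \sum_i \sum_j F i j.

Lemma lmx_sum_linear : linear lmx_sum.
Proof.
move=> c X Y; rewrite /lmx_sum scaler_sumr -big_split; apply: eq_bigr => i _ /=.
by rewrite scaler_sumr -big_split; apply: eq_bigr => j _; rewrite !mxE.
Qed.

Lemma lmx_sum1 : lmx_sum 1 = 1.
Proof.
rewrite -dsum_proj_sum; apply: eq_bigr => i _.
rewrite (bigD1 i) //= mxE eqxx big1 ?addr0 // => j /negPf ji.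
by rewrite mxE eq_sym ji.
Qed.

(** Two distinct, hence orthogonal, projections can be inserted between the factors. *)
Lemma lmx_entryM0 (X Y : L) i j j' l : j != j' -> X i j * Y j' l = 0.
Proof.
move=> /negPf jj'.
rewrite -(Dhat_hom_projr (lmx_valE X i j)) -(Dhat_hom_projl (lmx_valE Y j' l)).
rewrite mulrA -[X i j * _ * _]mulrA dsum_projM (inj_eq enum_val_inj).
by rewrite jj' mulr0 mul0r.
Qed.

(** In the product of the two sums only composable pairs of entries survive, and these are the terms
    of the matrix product. *)
Lemma lmx_sumM : {morph lmx_sum : X Y / X * Y}.
Proof.
move=> X Y; rewrite /lmx_sum mulr_suml; apply: eq_bigr => i _.
under eq_bigr do rewrite mxE.
rewrite exchange_big mulr_suml; apply: eq_bigr => j _ /=.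
rewrite mulr_sumr [RHS](bigD1 j) //= [X in _ + X]big1 ?addr0 => [|j' j'j].
  by rewrite mulr_sumr.
by rewrite mulr_sumr big1 // => l _; rewrite lmx_entryM0 // eq_sym.
Qed.

(** Orthogonality isolates row i on the left and column j on the right; injectivity of [lmx_sum]
    follows. *)
Lemma lmx_sumK (X : L) i j :
  dsum_proj phiC (enum_val i) * lmx_sum X * dsum_proj phiC (enum_val j) = X i j.
Proof.
have -> : dsum_proj phiC (enum_val i) * lmx_sum X = \sum_l X i l.
  rewrite mulr_sumr (bigD1 i) //= [X in _ + X]big1 => [|i' /negPf ii'].
    rewrite addr0 mulr_sumr; apply: eq_bigr => l _.
    exact: Dhat_hom_projl (lmx_valE X i l).
  rewrite mulr_sumr big1 // => l _; rewrite -(Dhat_hom_projl (lmx_valE X i' l)).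
  by rewrite mulrA dsum_projM (inj_eq enum_val_inj) eq_sym ii' mul0r.
rewrite mulr_suml (bigD1 j) //= big1 => [|l /negPf lj].
  by rewrite addr0; exact: Dhat_hom_projr (lmx_valE X i j).
rewrite -(Dhat_hom_projr (lmx_valE X i l)) -mulrA dsum_projM.
by rewrite (inj_eq enum_val_inj) lj mulr0.
Qed.

Lemma lmx_sum_inj : injective lmx_sum.
Proof. by move=> X Y XY; apply: lmx_eqP => i j; rewrite -!lmx_sumK XY. Qed.

Lemma lmx_sum_onto (f : E) : exists X, lmx_sum X = f.
Proof.
pose X := \matrix_(i < #|G|, j < #|G|)
  (dsum_proj phiC (enum_val i) * f * dsum_proj phiC (enum_val j)).
have XP : `[< in_lmx X >] by apply/asboolP => i j; rewrite mxE; exact: Dhat_hom_proj.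
(* Write f = 1 f 1 and expand both unities into sums of projections. *)
exists (Lmx XP); rewrite /lmx_sum -[RHS]mul1r -dsum_proj_sum mulr_suml.
apply: eq_bigr => i _; rewrite -[RHS]mulr1 -dsum_proj_sum mulr_sumr.
by apply: eq_bigr => j _; rewrite mxE.
Qed.

Lemma lmx_sum_iso : alg_isomorphic L E.
Proof.
exact: alg_isomorphicP lmx_sum_linear lmx_sum1 lmx_sumM lmx_sum_inj lmx_sum_onto.
Qed.

End MatrixEnd.

Theorem theorem7 (k : fieldType) (G : finGroupType) (A : algType k)
    (alpha : partial_module_algebra G A) (B : algType k)
    (beta : module_algebra G B) (phi : enveloping alpha beta)
    (phiC : env_units_central phi) :
  [/\ alg_isomorphic (dsmash alpha) (smx phiC),
      alg_isomorphic (smx phiC) (lmx phiC) &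
      alg_isomorphic (lmx phiC) (dsum_end phiC)].
Proof.
split; [exact: dsmash_smx_iso | exact: smx_lmx_iso | exact: lmx_sum_iso].
Qed.
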